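(* Let $\mathcal{A} \in \mathbb{R}^{I_1 \times \cdots \times I_N \times I_1 \times \cdots \times I_N}$ be a deterministic positive definite (PD) tensor, and let $\mathcal{X} \in \mathbb{R}^{I_1 \times \cdots \times I_N \times I_1 \times \cdots \times I_N}$ be a random Hermitian tensor such that $\mathcal{X} \succeq \mathcal{O}$ almost surely. Then $$\mathrm{Pr}\left(\mathcal{X} \not\preceq \mathcal{A}\right) \leq \mathrm{Tr}\left(\mathbb{E}[\mathcal{X}]\star_N \mathcal{A}^{-1}\right).$$
   Context: Square tensors in $\mathbb{C}^{I_1 \times \cdots \times I_N \times I_1 \times \cdots \times I_N}$ are multiplied by the Einstein product $(\mathcal{X}\star_N\mathcal{Y})_{i_1,\dots,i_N,k_1,\dots,k_N} = \sum_{j_1,\dots,j_N} x_{i_1,\dots,i_N,j_1,\dots,j_N}\,y_{j_1,\dots,j_N,k_1,\dots,k_N}$. The identity tensor $\mathcal{I}$ has entries $\prod_{k}\delta_{i_k,j_k}$, and $\mathcal{O}$ is the zero tensor. The inverse is taken with respect to $\star_N$. The conjugate transpose is $(\mathcal{X}^{\mathrm H})_{j_1,\dots,j_N,i_1,\dots,i_N}=\overline{x_{i_1,\dots,i_N,j_1,\dots,j_N}}$, and $\mathcal{X}$ is Hermitian if $\mathcal{X}^{\mathrm H}=\mathcal{X}$. The trace is $\mathrm{Tr}(\mathcal{X})=\sum_{i_1,\dots,i_N}x_{i_1,\dots,i_N,i_1,\dots,i_N}$. (Equivalently, these are square matrices of size $\prod_{j=1}^N I_j$ under unfolding, with the usual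 matrix product, trace, eigenvalues, etc.) A Hermitian tensor is PD if all its eigenvalues are positive and semipositive definite (SPD) if all its eigenvalues are nonnegative. $\mathcal{A}\preceq\mathcal{B}$ (equivalently $\mathcal{B}\succeq\mathcal{A}$) means $\mathcal{B}-\mathcal{A}$ is SPD, and $\mathcal{A}\not\preceq\mathcal{B}$ means $\mathcal{B}-\mathcal{A}$ is not SPD. Expectations are taken entrywise and are understood to exist. *)

(* Defs.v *)
From HB Require Import structures.
From mathcomp Require Import all_boot all_order all_algebra.
From mathcomp Require Import all_classical all_reals all_analysis.
From mathcomp Require Import complex.

Set Implicit Arguments.
Unset Strict Implicit.
Unset Printing Implicit Defensive.

Import Order.TTheory GRing.Theory Num.Theory.
Local Open Scope classical_set_scope.
Local Open Scope ring_scope.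

(* Multi-indices (i_1, ..., i_N) with 0 <= i_k < I_k (0-based). *)
Definition mindex (N : nat) (I : 'I_N -> nat) : Type :=
  {dffun forall k : 'I_N, 'I_(I k)}.
HB.instance Definition _ N (I : 'I_N -> nat) := Finite.on (mindex I).

(* K^(I_1 x ... x I_N x I_1 x ... x I_N): the two halves of the 2N indices are
   paired, so x_(i_1, ..., i_N, j_1, ..., j_N) is written X (i, j). *)
Definition tensor (K : Type) (N : nat) (I : 'I_N -> nat) : Type :=
  {ffun mindex I * mindex I -> K}.
HB.instance Definition _ (K : zmodType) N (I : 'I_N -> nat) :=
  GRing.Zmodule.on (tensor K I).

Section Algebra.
Variables (N : nat) (I : 'I_N -> nat).

Definition tmul (K : pzRingType) (X Y : tensor K I) : tensor K I :=
  [ffun p => \sum_(j : mindex I) X (p.1, j) * Y (j, p.2)].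

Definition tid (K : pzRingType) : tensor K I :=
  [ffun p : mindex I * mindex I => \prod_(k < N) (p.1 k == p.2 k)%:R].

Definition is_tinv (K : pzRingType) (A B : tensor K I) : Prop :=
  tmul A B = tid K /\ tmul B A = tid K.

(* The two-sided inverse for the Einstein product; a junk value (0) when the
   tensor is not invertible. *)
Definition tinv (K : pzRingType) (A : tensor K I) : tensor K I :=
  xget 0 [set B | is_tinv A B].

Definition ttrace (K : pzRingType) (X : tensor K I) : K :=
  \sum_(i : mindex I) X (i, i).

Definition tctrans (C : numClosedFieldType) (X : tensor C I) : tensor C I :=
  [ffun p => Num.conj (X (p.2, p.1))].

Definition thermitian (C : numClosedFieldType) (X : tensor C I) : Prop :=
  tctrans X = X.

Definition teigenvalue (K : fieldType) (X : tensor K I) (l : K) : Prop :=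
  exists2 V : {ffun mindex I -> K}, V != 0 &
    forall i : mindex I, \sum_(j : mindex I) X (i, j) * V j = l * V i.

(* In a numClosedFieldType, 0 < l and 0 <= l entail that l is real. *)
Definition tPD (C : numClosedFieldType) (X : tensor C I) : Prop :=
  thermitian X /\ forall l : C, teigenvalue X l -> 0 < l.

Definition tSPD (C : numClosedFieldType) (X : tensor C I) : Prop :=
  thermitian X /\ forall l : C, teigenvalue X l -> 0 <= l.

Definition tle (C : numClosedFieldType) (A B : tensor C I) : Prop :=
  tSPD (B - A).

(* A real tensor seen as a complex one. *)
Definition tcomplex (R : rcfType) (X : tensor R I) : tensor R[i] I :=
  [ffun p => (X p)%:C%C].

End Algebra.

Section Probability.
Variables (d : measure_display) (T : measurableType d) (R : realType).
Variables (P : probability T R) (N : nat) (I : 'I_N -> nat).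

Definition random_tensor (X : T -> tensor R I) : Prop :=
  forall p, measurable_fun [set: T] (fun w => X w p).

Definition has_texpect (X : T -> tensor R I) : Prop :=
  forall p, P.-integrable [set: T] (fun w => (X w p)%:E).

(* 'E_P[_] takes values in \bar R; it is finite under has_texpect. *)
Definition texpect (X : T -> tensor R I) : tensor R I :=
  [ffun p => fine ('E_P[fun w => X w p])%E].

End Probability.

(* Main.v *)
Require Import Defs.
From HB Require Import structures.
From mathcomp Require Import all_boot all_order all_algebra.
From mathcomp Require Import all_classical all_reals all_analysis.
From mathcomp Require Import measurable_realfun.
From mathcomp Require Import complex spectral sesquilinear.
From mathcomp Require Import ring.

(* Unfold tensors to real symmetric matrices.  If X >= 0 and v^T X v > v^T A v
   for some v, Cauchy-Schwarz for A^-1 makes A^-1 - v v^T / (v^T A v) positive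
   semidefinite; since the trace of a product of two positive semidefinite
   matrices is nonnegative, Tr(X A^-1) >= v^T X v / v^T A v >= 1.  So almost
   surely Tr(X A^-1) dominates the indicator of the event, and one integrates.
   The event is measurable because v may be taken among the countably many
   integer vectors. *)

Set Implicit Arguments.
Unset Strict Implicit.
Unset Printing Implicit Defensive.

Import Order.TTheory GRing.Theory Num.Theory.
Import numFieldNormedType.Exports.
Local Open Scope classical_set_scope.
Local Open Scope ring_scope.
Local Open Scope sesquilinear_scope.

(** * Quadratic forms of square matrices *)

Section Qform.
Variable R : comNzRingType.

Definition qform n (M : 'M[R]_n) (u : 'rV[R]_n) : R := (u *m M *m u^T) 0 0.

Lemma qformE n (M : 'M[R]_n) u :
  qform M u = \sum_j (\sum_i u 0 i * M i j) * u 0 j.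
Proof. by rewrite /qform mxE; apply: eq_bigr => j _; rewrite !mxE. Qed.

Lemma qformB n (M M' : 'M[R]_n) u : qform (M - M') u = qform M u - qform M' u.
Proof. by rewrite /qform mulmxBr mulmxBl !mxE. Qed.

Lemma qformZ (c : R) n (M : 'M[R]_n) u : qform (c *: M) u = c * qform M u.
Proof. by rewrite /qform -scalemxAr -scalemxAl mxE. Qed.

Lemma qformZr (c : R) n (M : 'M[R]_n) u : qform M (c *: u) = c ^+ 2 * qform M u.
Proof.
have cuT : (c *: u)^T = c *: u^T by apply/matrixP => i j; rewrite !mxE.
by rewrite /qform cuT -!scalemxAl -scalemxAr scalerA mxE.
Qed.

(** A 1 x 1 matrix equals its own transpose. *)
Lemma bilin_sym n (M : 'M[R]_n) (u v : 'rV[R]_n) : M^T = M ->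
  v *m M *m u^T = u *m M *m v^T.
Proof.
move=> sM; rewrite [LHS]mx11_scalar -tr_scalar_mx -mx11_scalar.
by rewrite !trmx_mul trmxK sM mulmxA.
Qed.

Lemma qformBZ n (M : 'M[R]_n) (u v : 'rV[R]_n) (c : R) : M^T = M ->
  qform M (u - c *: v) =
  qform M u - 2 * c * (u *m M *m v^T) 0 0 + c ^+ 2 * qform M v.
Proof.
move=> sM; have -> : qform M (u - c *: v) =
    ((u - c *: v) *m M *m (u^T - c *: v^T)) 0 0.
  by congr ((_ *m _) 0 0); apply/matrixP => i j; rewrite !mxE.
rewrite /qform !mulmxBl !mulmxBr.
rewrite -!scalemxAl -!scalemxAr (bilin_sym u v sM) !mxE; ring.
Qed.

Lemma qform_mulmx n (M B : 'M[R]_n) u :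
  qform M (u *m B) = qform (B *m M *m B^T) u.
Proof. by rewrite /qform trmx_mul !mulmxA. Qed.

Lemma qform_outer n (u v : 'rV[R]_n) : qform (v^T *m v) u = (u *m v^T) 0 0 ^+ 2.
Proof.
have vu : v *m u^T = (u *m v^T)^T by rewrite trmx_mul trmxK.
rewrite /qform mulmxA -[_ *m v *m _]mulmxA mxE big_ord1 vu.
by rewrite [(_^T) _ _]mxE.
Qed.

Lemma mxtrace_mul_outer n (M : 'M[R]_n) (v : 'rV[R]_n) :
  \tr (M *m (v^T *m v)) = qform M v.
Proof. by rewrite mulmxA mxtrace_mulC mulmxA trace_mx11. Qed.

End Qform.

Lemma trmxC_mul (C : numClosedFieldType) m n p
    (M : 'M[C]_(m, n)) (M' : 'M[C]_(n, p)) :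
  (M *m M')^t* = M'^t* *m M^t*.
Proof. by rewrite trmx_mul map_mxM. Qed.

(** * Real symmetric matrices and their complex spectrum *)

Section Psd.
Variable R : rcfType.

Local Notation toC := (map_mx (real_complex R)).

Definition psd n (M : 'M[R]_n) := forall u, 0 <= qform M u.

Lemma trmxC_real m n (M : 'M[R]_(m, n)) : (toC M)^t* = toC (M^T).
Proof. by apply/matrixP => i j; rewrite !mxE; exact: conjc_real. Qed.

Lemma complex_mxE m n (u : 'M[R[i]]_(m, n)) :
  u = toC (map_mx (@complex.Re R) u) + 'i *: toC (map_mx (@complex.Im R) u).
Proof. by apply/matrixP => i j; rewrite !mxE {1}[u i j]complexE. Qed.

(** Writing u = a + i b, the cross terms i (b M a^T - a M b^T) cancel because M is symmetric. *)
Lemma hform_complex n (M : 'M[R]_n) (u : 'rV[R[i]]_n) : M^T = M ->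
  (u *m toC M *m u^t*) 0 0 =
  (qform M (map_mx (@complex.Re R) u) + qform M (map_mx (@complex.Im R) u))%:C%C.
Proof.
move=> sM; rewrite {1 2}[u]complex_mxE.
set a := map_mx (@complex.Re R) u; set b := map_mx (@complex.Im R) u.
have -> : (toC a + 'i *: toC b)^t* = toC (a^T) - 'i *: toC (b^T).
  rewrite -!trmxC_real; apply/matrixP => i j; rewrite !mxE rmorphD rmorphM /=.
  by rewrite conjCi mulNr.
rewrite mulmxBr !mulmxDl -!scalemxAr -!scalemxAl -!map_mxM /=.
rewrite (bilin_sym a b sM).
rewrite scalerA -expr2 sqrCi scaleN1r addrC opprD opprK addrA.
by rewrite [in LHS]mxE /qform rmorphD !mxE /=; ring.
Qed.

Lemma psd_hform n (M : 'M[R]_n) (u : 'rV[R[i]]_n) : M^T = M -> psd M ->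
  0 <= (u *m toC M *m u^t*) 0 0.
Proof. by move=> sM pM; rewrite hform_complex// ler0c addr_ge0. Qed.

Lemma dot_conj_gt0 n (u : 'rV[R[i]]_n) : u != 0 -> 0 < (u *m u^t*) 0 0.
Proof.
case/rV0Pn => i ui; rewrite mxE (bigD1 i)//= ltr_wpDr//.
  by apply: sumr_ge0 => j _; rewrite !mxE -normCK exprn_ge0.
by rewrite !mxE -normCK exprn_gt0// normr_gt0.
Qed.

(** A real symmetric matrix is Hermitian over the complex numbers, hence normal, hence unitarily
    diagonalisable; the rows of the unitary matrix are unit left eigenvectors. *)
Lemma symmetric_spectral n (M : 'M[R]_n) : M^T = M ->
  exists (U : 'M[R[i]]_n) (D : 'rV[R[i]]_n),
    [/\ toC M = U^t* *m diag_mx D *m U,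
        forall k, row k U *m toC M = D 0 k *: row k U &
        forall k, (row k U *m (row k U)^t*) 0 0 = 1].
Proof.
move=> sM; pose U := spectralmx (toC M); pose D := spectral_diag (toC M).
have UU : U *m U^t* = 1%:M by exact/unitarymxP/spectral_unitarymx.
have eqM : toC M = U^t* *m diag_mx D *m U.
  rewrite -invmx_unitary ?spectral_unitarymx//; apply/orthomx_spectralP.
  by apply/normalmxP; rewrite trmxC_real sM.
exists U, D; split=> // k.
  rewrite -row_mul eqM !mulmxA UU mul1mx.
  by rewrite row_mul row_diag_mx -scalemxAl -rowE.
have -> : (row k U *m (row k U)^t*) 0 0 = (U *m U^t*) k k.
  by rewrite mxE [RHS]mxE; apply: eq_bigr => j _; rewrite !mxE.
by rewrite UU mxE eqxx.
Qed.

(** For an eigenvector v, v M v^* = l |v|^2 gives the sign of l. Conversely, in the eigenbasis the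
    form is the sum of the D_k |w_k|^2. Eigenvalues range over [R[i]] to match [teigenvalue]. *)
Lemma psd_eigenP n (M : 'M[R]_n) : M^T = M ->
  psd M <-> forall (l : R[i]) (v : 'rV[R[i]]_n),
    v != 0 -> v *m toC M = l *: v -> 0 <= l.
Proof.
move=> sM; split=> [pM l v v0 vM|eM u].
  have := psd_hform v sM pM; rewrite vM -scalemxAl mxE.
  by rewrite pmulr_lge0 ?dot_conj_gt0.
have [U [D [eqM UM U1]]] := symmetric_spectral sM.
have D_ge0 k : 0 <= D 0 k.
  apply: (eM _ (row k U)) => //; apply/eqP => Uk0.
  by have /eqP := U1 k; rewrite Uk0 mul0mx mxE eq_sym oner_eq0.
have hu : 0 <= (toC u *m toC M *m (toC u)^t*) 0 0.
  have -> : toC u *m toC M *m (toC u)^t* =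
      (toC u *m U^t*) *m diag_mx D *m (toC u *m U^t*)^t*.
    by rewrite trmxC_mul (trmxCK U) eqM !mulmxA.
  move: (_ *m U^t*) => w.
  rewrite mxE sumr_ge0// => k _; rewrite mul_mx_diag [X in X * _]mxE.
  rewrite [X in _ * X]mxE [X in _ * _ X]mxE mulrAC.
  by rewrite mulr_ge0// -normCK exprn_ge0.
by rewrite trmxC_real -!map_mxM mxE ler0c in hu.
Qed.

Lemma mxtrace_mul_psd n (M M' : 'M[R]_n) : M^T = M -> psd M ->
  M'^T = M' -> psd M' -> 0 <= \tr (M *m M').
Proof.
move=> sM pM sM' pM'; have [U [D [eqM UM U1]]] := symmetric_spectral sM.
have D_ge0 k : 0 <= D 0 k.
  have := psd_hform (row k U) sM pM.
  by rewrite UM -scalemxAl mxE U1 mulr1.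
suff : 0 <= \tr (toC M *m toC M') by rewrite -map_mxM trace_map_mx ler0c.
rewrite eqM -!mulmxA mxtrace_mulC -!mulmxA sumr_ge0// => k _.
rewrite mul_diag_mx mxE mulr_ge0//.
have -> : (U *m (toC M' *m U^t*)) k k =
    (row k U *m toC M' *m (row k U)^t*) 0 0.
  rewrite mulmxA -row_mul mxE [RHS]mxE; apply: eq_bigr => j _.
  by rewrite [row _ _ _ _]mxE; congr (_ * _); rewrite !mxE.
exact: psd_hform.
Qed.

End Psd.

(** * Inverses of positive definite matrices and the trace bound *)

Section Inverse.
Variables (R : rcfType) (n : nat).
Implicit Types (A X : 'M[R]_n) (u v : 'rV[R]_n).

Lemma psd_unit_gt0 A v : A^T = A -> psd A -> A \in unitmx -> v != 0 ->
  0 < qform A v.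
Proof.
move=> sA pA uA v0; rewrite lt_def pA andbT; apply/eqP => qv0.
(* Were qform A v = 0, the form would be affine along w + t v with slope
   2 |v A|^2 > 0, hence negative somewhere. *)
pose w := v *m A.
have b_gt0 : 0 < (w *m A *m v^T) 0 0.
  have -> : w *m A *m v^T = w *m w^T by rewrite /w trmx_mul sA !mulmxA.
  have /rV0Pn[i wi] : w != 0.
    apply/eqP => /(congr1 (mulmx^~ (invmx A)))/eqP.
    by rewrite mulmxK// mul0mx (negPf v0).
  rewrite mxE (bigD1 i)//= ltr_wpDr//.
    by apply: sumr_ge0 => j _; rewrite [_^T _ _]mxE -expr2 sqr_ge0.
  by rewrite [_^T _ _]mxE -expr2 lt_def sqr_ge0 expf_eq0/= wi.
set b := (_ 0 0) in b_gt0.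
(* The coefficient solves qform A w - 2 c b = -1. *)
have := pA (w - ((qform A w + 1) / (2 * b)) *: v).
rewrite qformBZ// qv0 mulr0 addr0 -/b.
have -> : qform A w - 2 * ((qform A w + 1) / (2 * b)) * b = -1.
  by field; rewrite lt0r_neq0.
by rewrite lerNr oppr0 ler10.
Qed.

Lemma invmx_sym A : A^T = A -> (invmx A)^T = invmx A.
Proof. by move=> sA; rewrite trmx_inv sA. Qed.

(** The form of A^-1 at u is the form of A at u A^-1. *)
Lemma psd_invmx A : A^T = A -> psd A -> A \in unitmx -> psd (invmx A).
Proof.
move=> sA pA uA u; have := pA (u *m invmx A).
by rewrite qform_mulmx invmx_sym// mulVmx// mul1mx.
Qed.

Lemma mxtrace_mul_invmx_ge1 A X v : A^T = A -> psd A -> A \in unitmx ->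
  X^T = X -> psd X -> qform (A - X) v < 0 -> 1 <= \tr (X *m invmx A).
Proof.
move=> sA pA uA sX pX; rewrite qformB subr_lt0 => AX.
have v0 : v != 0.
  by apply: contraTneq AX => ->; rewrite /qform !mul0mx mxE ltxx.
have a_gt0 := psd_unit_gt0 sA pA uA v0.
pose Q := invmx A - (qform A v)^-1 *: (v^T *m v).
have sQ : Q^T = Q.
  rewrite /Q -[in RHS](invmx_sym sA) -[in RHS](trmxK v) -trmx_mul trmxK.
  by apply/matrixP => i j; rewrite !mxE.
have pQ : psd Q.
  move=> x; rewrite /Q qformB qformZ qform_outer.
  (* Cauchy-Schwarz: the form of A^-1 at its residual of x along v A. *)
  have := psd_invmx sA pA uA (x - ((x *m v^T) 0 0 / qform A v) *: (v *m A)).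
  rewrite qformBZ ?invmx_sym// trmx_mul sA -!mulmxA mulKmx//.
  rewrite qform_mulmx sA mulmxV// mul1mx.
  congr (0 <= _); field; exact: lt0r_neq0.
have := mxtrace_mul_psd sX pX sQ pQ.
rewrite /Q mulmxBr raddfB /= -scalemxAr mxtraceZ mxtrace_mul_outer subr_ge0.
by apply: le_trans; rewrite mulrC ler_pdivlMr// mul1r ltW.
Qed.

End Inverse.

(** By continuity the form stays negative at a rational vector close to a; clearing the denominator
    only multiplies it by a positive square. Finite functions into [int] form a countable type, as
    the union over k in [measurable_not_tle] requires. *)
Lemma qform_lt0_int (R : realType) n (M : 'M[R]_n) (a : 'rV[R]_n) :
  qform M a < 0 ->
  exists k : {ffun 'I_n -> int}, qform M (\row_i (k i)%:~R) < 0.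
Proof.
move=> Ma.
pose k m : {ffun 'I_n -> int} := [ffun i => Num.floor (m.+1%:R * a 0 i)].
pose u m : 'rV[R]_n := \row_i ((k m i)%:~R / m.+1%:R).
have cu i : u m 0 i @[m --> \oo] --> a 0 i.
  (* The floor loses less than 1, so dividing by m + 1 leaves an error below 1 / (m + 1). *)
  apply: (@squeeze_cvgr _ _ _ _ (fun m => a 0 i - m.+1%:R^-1) (cst (a 0 i))).
  - near=> m; rewrite !mxE !ffunE ler_pdivrMr// ler_pdivlMr//.
    rewrite mulrBl mulVf// [a 0 i * _]mulrC floor_le andbT.
    by rewrite lerBlDr ltW// -[1]/(1%:~R) -intrD floorD1_gt.
  - rewrite -[X in _ --> X]subr0; apply: cvgB; first exact: cvg_cst.
    exact: cvg_harmonic.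
  - exact: cvg_cst.
have cq : qform M (u m) @[m --> \oo] --> qform M a.
  under eq_fun do rewrite qformE.
  rewrite qformE; apply: cvg_big => [|j _]; first exact: add_continuous.
  apply: cvgM => //; apply: cvg_big => [|i _]; first exact: add_continuous.
  by apply: cvgM => //; exact: cvg_cst.
have [m _ /(_ m (leqnn m))/= Mu] : \forall m \near \oo, qform M (u m) < 0.
  exact: (cvgr_lt (qform M a)).
exists (k m).
have -> : (\row_i (k m i)%:~R : 'rV[R]_n) = m.+1%:R *: u m.
  by apply/rowP => i; rewrite !mxE mulrC divfK.
by rewrite qformZr pmulr_rlt0.
Unshelve. all: by end_near.
Qed.

(** * Unfolding of tensors into matrices *)

Section Unfolding.
Variables (N : nat) (I : 'I_N -> nat).
Local Notation dim := #|{: mindex I}|.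

Definition tmx (K : Type) (X : tensor K I) : 'M[K]_dim :=
  \matrix_(i, j) X (enum_val i, enum_val j).

Definition mxt (K : Type) (M : 'M[K]_dim) : tensor K I :=
  [ffun p => M (enum_rank p.1) (enum_rank p.2)].

Lemma mxtK (K : Type) : cancel (@mxt K) (@tmx K).
Proof. by move=> M; apply/matrixP => i j; rewrite mxE ffunE !enum_valK. Qed.

Lemma tmxK (K : Type) : cancel (@tmx K) (@mxt K).
Proof. by move=> X; apply/ffunP => -[i j]; rewrite ffunE mxE !enum_rankK. Qed.

Lemma sum_mindex (V : nmodType) (F : mindex I -> V) :
  \sum_i F i = \sum_(i < dim) F (enum_val i).
Proof. exact: (reindex _ (onW_bij _ (@enum_val_bij _))). Qed.

Lemma tmx_mul (K : pzRingType) (X Y : tensor K I) :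
  tmx (tmul X Y) = tmx X *m tmx Y.
Proof.
apply/matrixP => i j; rewrite !mxE ffunE sum_mindex.
by apply: eq_bigr => k _; rewrite !mxE.
Qed.

Lemma tmx_id (K : comPzRingType) : tmx (tid I K) = 1%:M.
Proof.
apply/matrixP => i j; rewrite !mxE ffunE /=.
have [->|ij] := eqVneq i j; first by rewrite big1// => k _; rewrite eqxx.
(* Distinct multi-indices differ in some coordinate, and that factor kills the product of deltas. *)
have /existsP[k ijk] : [exists k, enum_val i k != enum_val j k].
  rewrite -negb_forall; apply: contra ij => /forallP ij.
  by apply/eqP/enum_val_inj/ffunP => k; exact/eqP.
by rewrite (bigD1 k)//= (negPf ijk) mul0r.
Qed.

Lemma ttrace_mx (K : pzRingType) (X : tensor K I) : ttrace X = \tr (tmx X).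
Proof. by rewrite /ttrace sum_mindex; apply: eq_bigr => i _; rewrite mxE. Qed.

Lemma tmxB (K : zmodType) (X Y : tensor K I) : tmx (X - Y) = tmx X - tmx Y.
Proof. by apply/matrixP => i j; rewrite !mxE !ffunE. Qed.

(** Folding [invmx] back exhibits an inverse, so [xget] does not return its default; inverses being
    unique, the chosen one unfolds to [invmx]. *)
Lemma tmx_inv (K : comUnitRingType) (A : tensor K I) : tmx A \in unitmx ->
  tmx (tinv A) = invmx (tmx A).
Proof.
move=> uA; have [AB _] : is_tinv A (tinv A).
  apply: (@xgetPex _ 0 [set B | is_tinv A B]); exists (mxt (invmx (tmx A))).
  split; apply: (can_inj (@tmxK K));
    by rewrite tmx_mul tmx_id mxtK ?mulmxV ?mulVmx.
by rewrite -[LHS](mulKmx uA) -tmx_mul AB tmx_id mulmx1.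
Qed.

Section Real.
Variable R : rcfType.
Implicit Types X Y : tensor R I.

Lemma tcomplexB X Y : tcomplex X - tcomplex Y = tcomplex (X - Y).
Proof. by apply/ffunP => p; rewrite !ffunE rmorphB. Qed.

Lemma thermitian_sym X : thermitian (tcomplex X) <-> (tmx X)^T = tmx X.
Proof.
split=> [hX|sX].
  apply/matrixP => i j; rewrite !mxE.
  move/ffunP/(_ (enum_val i, enum_val j)): hX; rewrite !ffunE /=.
  by move=> h; apply: complexI; rewrite -h; exact/esym/conjc_real.
apply/ffunP => -[i j]; rewrite !ffunE /=.
move/matrixP/(_ (enum_rank i) (enum_rank j)): sX; rewrite !mxE !enum_rankK => <-.
exact: conjc_real.
Qed.

(** [teigenvalue] multiplies column vectors whereas matrices here act on rows; symmetry identifies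
    the two. *)
Lemma teigenvalue_mx X l : (tmx X)^T = tmx X ->
  teigenvalue (tcomplex X) l <->
  exists2 v : 'rV[R[i]]_dim, v != 0 &
    v *m map_mx (real_complex R) (tmx X) = l *: v.
Proof.
move=> /matrixP sX; split=> -[V V0 XV].
- exists (\row_i V (enum_val i)).
    apply: contra V0 => /eqP/rowP v0; apply/eqP/ffunP => i.
    by have := v0 (enum_rank i); rewrite !mxE enum_rankK ffunE.
  apply/rowP => i; rewrite !mxE -XV sum_mindex; apply: eq_bigr => j _.
  by rewrite [map_mx _ _ _ _]mxE -sX !mxE !ffunE mulrC.
- exists [ffun i => V 0 (enum_rank i)].
    apply: contra V0 => /eqP/ffunP v0; apply/eqP/rowP => i.
    by have := v0 (enum_val i); rewrite !ffunE enum_valK mxE.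
  move=> i; move/rowP/(_ (enum_rank i)): XV; rewrite !mxE ffunE => <-.
  rewrite sum_mindex; apply: eq_bigr => j _.
  by rewrite [map_mx _ _ _ _]mxE -sX !mxE !ffunE enum_rankK enum_valK mulrC.
Qed.

Lemma tSPD_psd X : thermitian (tcomplex X) ->
  tSPD (tcomplex X) <-> psd (tmx X).
Proof.
move=> hX; have sX := (thermitian_sym X).1 hX; rewrite (psd_eigenP sX).
split=> [[_ eX] l v v0 Xv|eX].
  by apply: eX; apply/teigenvalue_mx => //; exists v.
by split=> // l /(teigenvalue_mx l sX)[v v0]; exact: eX.
Qed.

(** A nonzero kernel vector would make 0 an eigenvalue. *)
Lemma tPD_unitmx X : tPD (tcomplex X) -> tmx X \in unitmx.
Proof.
move=> [hX eX]; have sX := (thermitian_sym X).1 hX.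
rewrite -(map_unitmx (real_complex R)) -row_free_unit -kermx_eq0.
apply/negP => /negP/rowV0Pn[v /sub_kermxP vX v0].
suff /eX : teigenvalue (tcomplex X) 0 by rewrite ltxx.
by apply/(teigenvalue_mx _ sX); exists v; rewrite // vX scale0r.
Qed.

Lemma tPD_SPD X : tPD (tcomplex X) -> tSPD (tcomplex X).
Proof. by move=> [hX eX]; split=> // l /eX /ltW. Qed.

End Real.
End Unfolding.

(** * Measurability of the event, and integration *)

Section Event.
Context d (T : measurableType d) (R : realType) (N : nat) (I : 'I_N -> nat).
Implicit Types X : T -> tensor R I.

(** Replaces the uncountable choice of a vector by a countable one, so that the event becomes a
    countable union. *)
Lemma not_tleE (A B : tensor R I) :
  thermitian (tcomplex A) -> thermitian (tcomplex B) ->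
  ~ tle (tcomplex B) (tcomplex A) <->
  exists k : {ffun 'I_#|{: mindex I}| -> int},
    qform (tmx A - tmx B) (\row_i (k i)%:~R) < 0.
Proof.
move=> /thermitian_sym sA /thermitian_sym sB.
rewrite /tle tcomplexB -tmxB.
have hAB : thermitian (tcomplex (A - B)).
  apply/thermitian_sym; rewrite tmxB -[in RHS]sA -[in RHS]sB.
  by apply/matrixP => i j; rewrite !mxE.
rewrite (tSPD_psd hAB); split=> [/existsNP[u /negP]|[k + pAB]].
  by rewrite -ltNge => /qform_lt0_int.
by rewrite ltNge pAB.
Qed.

Lemma measurable_not_tle (A : tensor R I) X :
  thermitian (tcomplex A) -> random_tensor X ->
  (forall w, thermitian (tcomplex (X w))) ->
  measurable [set w | ~ tle (tcomplex (X w)) (tcomplex A)].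
Proof.
move=> hA mX hX.
have -> : [set w | ~ tle (tcomplex (X w)) (tcomplex A)] =
    \bigcup_(k : {ffun 'I_#|{: mindex I}| -> int})
      [set w | qform (tmx A - tmx (X w)) (\row_i (k i)%:~R) < 0].
  apply/seteqP; split=> w /=.
    by move=> /(not_tleE hA (hX w))[k ?]; exists k.
  by move=> [k _ ?]; apply/(not_tleE hA (hX w)); exists k.
apply: countable_bigcupT_measurable => // k.
(* For fixed k the form is affine in the entries of X, and its set of negativity is the preimage of
   a half-line. *)
have mq : measurable_fun [set: T]
    (fun w => qform (tmx A - tmx (X w)) (\row_i (k i)%:~R)).
  under eq_fun do rewrite qformE.
  apply: measurable_sum => j; apply: measurable_funM => //.
  apply: measurable_sum => i; apply: measurable_funM => //.
  under eq_fun do rewrite !mxE.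
  by apply: measurable_funB.
rewrite -[X in measurable X]setTI.
have := mq measurableT _ (measurable_itv `]-oo, 0[).
by congr (measurable (_ `&` _)); apply/seteqP; split=> w /=; rewrite in_itv.
Qed.

(** The trace against a fixed B is a finite linear combination of the entries of X, so the integral
    passes through it. *)
Lemma integral_ttrace_tmul (P : probability T R) X (B : tensor R I) :
  has_texpect P X ->
  P.-integrable [set: T] (fun w => (ttrace (tmul (X w) B))%:E) /\
  (\int[P]_w (ttrace (tmul (X w) B))%:E =
    (ttrace (tmul (texpect P X) B))%:E)%E.
Proof.
move=> iX.
have trE (Y : tensor R I) : (ttrace (tmul Y B))%:E =
    (\sum_i \sum_j (B (j, i))%:E * (Y (i, j))%:E)%E.
  rewrite /ttrace -sumEFin; apply: eq_bigr => i _.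
  by rewrite ffunE -sumEFin; apply: eq_bigr => j _; rewrite mulrC.
have iXB i j :
    P.-integrable [set: T] (fun w => (B (j, i))%:E * (X w (i, j))%:E)%E.
  by apply: integrableZl.
have iXBs i : P.-integrable [set: T]
    (fun w => \sum_j (B (j, i))%:E * (X w (i, j))%:E)%E.
  exact: integrable_sum.
split; under eq_fun do rewrite trE.
  exact: integrable_sum.
rewrite integral_sum// trE; apply: eq_bigr => i _.
rewrite integral_sum//; apply: eq_bigr => j _.
(* The [fine] in [texpect] is faithful because an integrable entry has a finite expectation. *)
rewrite integralZl// ffunE unlock fineK//.
exact: integrable_fin_num.
Qed.

(** Markov's inequality in the form needed here: f dominates the indicator of E almost
    everywhere. *)
Lemma markov_ae (P : probability T R) (E : set T) (f : T -> R) :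
  measurable E -> P.-integrable [set: T] (fun w => (f w)%:E) ->
  {ae P, forall w, 0 <= f w /\ (E w -> 1 <= f w)} ->
  (P E <= \int[P]_w (f w)%:E)%E.
Proof.
move=> mE intf fP.
have mf : measurable_fun [set: T] f.
  by apply/measurable_EFinP; exact: measurable_int intf.
(* The comparison of integrals wants functions nonnegative everywhere, so f is replaced by its
   positive part, which agrees with it almost everywhere. *)
have mf0 : measurable_fun [set: T] (fun w => (Num.max (f w) 0)%:E).
  by apply/measurable_EFinP; exact: measurable_maxr.
have -> : (\int[P]_w (f w)%:E = \int[P]_w (Num.max (f w) 0)%:E)%E.
  apply: ae_eq_integral => //; first exact: measurable_int intf.
  by apply: filterS fP => w [f0 _] _; rewrite max_l.
rewrite -[E]setIT -integral_indic//.
apply: ae_ge0_le_integral => //.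
- by apply/measurable_EFinP; exact: measurable_indic.
- by move=> w _; rewrite lee_fin le_max lexx orbT.
apply: filterS fP => w [f0 Ef] _; rewrite lee_fin max_l// indicE.
by have [/set_mem/Ef|] := boolP (w \in E).
Qed.

End Event.

Theorem theorem1 (d : measure_display) (T : measurableType d) (R : realType)
    (P : probability T R) (N : nat) (I : 'I_N -> nat)
    (A : tensor R I) (X : T -> tensor R I)
    (A_PD : tPD (tcomplex A))
    (X_random : random_tensor X)
    (X_expect : has_texpect P X)
    (X_hermitian : forall w : T, thermitian (tcomplex (X w)))
    (X_SPD : {ae P, forall w : T, tle 0 (tcomplex (X w))}) :
  (P [set w : T | ~ tle (tcomplex (X w)) (tcomplex A)]
     <= (ttrace (tmul (texpect P X) (tinv A)))%:E)%E.
Proof.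
have hA := A_PD.1; have sA := (thermitian_sym A).1 hA.
have pA := (tSPD_psd hA).1 (tPD_SPD A_PD).
have uA := tPD_unitmx A_PD.
(* The bound becomes the integral of Tr(X A^-1), to which Markov's inequality applies. *)
have [iXA <-] := integral_ttrace_tmul (tinv A) X_expect.
apply: markov_ae => //; first exact: measurable_not_tle.
apply: filterS X_SPD => w; rewrite /tle subr0 => /(tSPD_psd (X_hermitian w)) pX.
have sX := (thermitian_sym (X w)).1 (X_hermitian w).
rewrite ttrace_mx tmx_mul tmx_inv//; split.
  apply: mxtrace_mul_psd => //; [exact: invmx_sym|exact: psd_invmx].
move=> /(not_tleE hA (X_hermitian w))[k].
exact: mxtrace_mul_invmx_ge1.
Qed.
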